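(* For all positive integers $a,b$ with $a=1$ or $b=1$, Player 1 wins the Strings-and-Coins game on the complete bipartite graph $K(a,b)$ under optimal play.
   Context: Strings-and-Coins game: played on a finite graph in which every vertex initially has at least one incident edge. Two players, Player 1 moving first, alternately remove one edge. Whenever a removal leaves one or more vertices with no incident edges, the mover earns one point for each such vertex and must move again, provided edges remain. The game ends when no edges remain; a player wins if they have more points. Optimal play means each player maximizes (own final score) minus (opponent's final score). $K(a,b)$ denotes the complete bipartite graph with parts of sizes $a$ and $b$. *)

(* Defs.v *)
From mathcomp Require Import all_boot all_order all_algebra.

Set Implicit Arguments.
Unset Strict Implicit.
Unset Printing Implicit Defensive.

Import Order.TTheory GRing.Theory Num.Theory.

(* A graph on the vertex set V is given by its set of edges F, each edge being
   the set of its endpoints. *)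

Definition has_edge (V : finType) (F : {set {set V}}) (v : V) : bool :=
  [exists d in F, v \in d].

(* Points earned by removing d: vertices that lose their last incident edge. *)
Definition points (V : finType) (F : {set {set V}}) (d : {set V}) : nat :=
  #|[set v | has_edge F v && ~~ has_edge (F :\ d) v]|.

Inductive player := P1 | P2.

Definition opponent (p : player) : player := if p is P1 then P2 else P1.

Record state (V : finType) := State {
  edges : {set {set V}};
  mover : player;
  score1 : nat;
  score2 : nat
}.

Definition score (V : finType) (p : player) (st : state V) : nat :=
  if p is P1 then score1 st else score2 st.

Definition start (V : finType) (E : {set {set V}}) : state V :=
  State E P1 0 0.

Definition remove (V : finType) (st : state V) (d : {set V}) : state V :=
  let k := points (edges st) d in
  let F := edges st :\ d in
  if k == 0 then State F (opponent (mover st)) (score1 st) (score2 st)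
  else if mover st is P1 then State F P1 (score1 st + k) (score2 st)
  else State F P2 (score1 st) (score2 st + k).

(* A history is the list of the edges removed so far, most recent first. *)
Definition history (V : finType) := seq {set V}.

Fixpoint position (V : finType) (E : {set {set V}}) (h : history V) : state V :=
  if h is d :: h' then remove (position E h') d else start E.

Definition strategy (V : finType) := history V -> {set V}.

Definition legal (V : finType) (E : {set {set V}}) (s : strategy V) : Prop :=
  forall h, edges (position E h) != set0 -> s h \in edges (position E h).

Fixpoint play (V : finType) (E : {set {set V}}) (s1 s2 : strategy V)
    (n : nat) : history V :=
  if n is n'.+1 then
    let h := play E s1 s2 n' in
    (if mover (position E h) is P1 then s1 h else s2 h) :: h
  else [::].

(* Each move removes exactly one edge, so the game lasts #|E| moves. *)
Definition final (V : finType) (E : {set {set V}}) (s1 s2 : strategy V) :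
    state V :=
  position E (play E s1 s2 #|E|).

Definition margin (V : finType) (p : player) (st : state V) : int :=
  ((score p st)%:Z - (score (opponent p) st)%:Z)%R.

(* Each player's strategy maximizes that player's final margin, given the
   strategy of the other one.  The game being zero-sum, all such pairs of
   strategies have the same margin, namely the minimax value of the game. *)
Definition optimal (V : finType) (E : {set {set V}}) (s1 s2 : strategy V) :
    Prop :=
  [/\ legal E s1, legal E s2,
      forall t, legal E t ->
        (margin P1 (final E t s2) <= margin P1 (final E s1 s2))%R
    & forall t, legal E t ->
        (margin P2 (final E s1 t) <= margin P2 (final E s1 s2))%R].

Definition wins (V : finType) (p : player) (st : state V) : Prop :=
  score (opponent p) st < score p st.

(* The first conjunct makes the second one non-vacuous. *)
Definition wins_under_optimal_play (V : finType) (p : player)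
    (E : {set {set V}}) : Prop :=
  (exists s1 s2, optimal E s1 s2) /\
  (forall s1 s2, optimal E s1 s2 -> wins p (final E s1 s2)).

Definition K (a b : nat) : {set {set ('I_a + 'I_b)%type}} :=
  [set [set inl i; inr j] | i : 'I_a, j : 'I_b].

Lemma K_has_edge (a b : nat) (v : 'I_a + 'I_b) :
  0 < a -> 0 < b -> has_edge (K a b) v.
Proof.
move=> ha hb; apply/exists_inP; case: v => [i|j].
  exists [set inl i; inr (Ordinal hb)]; first exact: imset2_f.
  by rewrite !inE eqxx.
exists [set inl (Ordinal ha); inr j]; first exact: imset2_f.
by rewrite !inE eqxx orbT.
Qed.

(* Main.v *)
Require Import Defs.
From mathcomp Require Import all_boot all_order all_algebra.

(** In a star every edge has an endpoint lying on no other edge.  Removing any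
    edge therefore scores, so the turn never passes and Player 1 collects every
    vertex, whatever strategies are followed. *)

Set Implicit Arguments.
Unset Strict Implicit.
Unset Printing Implicit Defensive.

Definition covered (V : finType) (F : {set {set V}}) : {set V} :=
  [set v | has_edge F v].

(** For ordinary two-element edges this describes disjoint unions of stars. Unlike being a single
    star, the condition is phrased so that it visibly survives the removal of edges. *)
Definition all_pendant (V : finType) (E : {set {set V}}) : Prop :=
  forall d, d \in E ->
    exists2 v, v \in d & forall e, e \in E -> v \in e -> e = d.

Lemma all_pendantS (V : finType) (E F : {set {set V}}) :
  F \subset E -> all_pendant E -> all_pendant F.
Proof.
move=> /subsetP sFE pE d dF; have [v vd uniq_d] := pE d (sFE d dF).
by exists v => // e /sFE; apply: uniq_d.
Qed.

Lemma coveredS (V : finType) (F G : {set {set V}}) :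
  F \subset G -> covered F \subset covered G.
Proof.
move=> /subsetP sFG; apply/subsetP => v; rewrite !inE => /exists_inP[d dF vd].
by apply/exists_inP; exists d; first exact: sFG.
Qed.

Lemma covered0 (V : finType) : covered (set0 : {set {set V}}) = set0.
Proof. by apply/setP => v; rewrite !inE; apply/exists_inP => -[d]; rewrite inE. Qed.

(** Removing an edge can only uncover vertices, so the points earned are exactly the drop in the
    number of covered vertices. *)
Lemma points_covered (V : finType) (F : {set {set V}}) (d : {set V}) :
  points F d + #|covered (F :\ d)| = #|covered F|.
Proof.
rewrite -(cardsID (covered (F :\ d)) (covered F)) addnC.
rewrite (setIidPr (coveredS (subsetDl F [set d]))); congr (_ + _).
by apply: eq_card => v; rewrite !inE andbC.
Qed.

Lemma points_pendant (V : finType) (F : {set {set V}}) (d : {set V}) :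
  all_pendant F -> d \in F -> 0 < points F d.
Proof.
move=> pF dF; have [v vd uniq_d] := pF d dF.
apply/card_gt0P; exists v; rewrite inE; apply/andP; split.
  by apply/exists_inP; exists d.
apply/exists_inP => -[e]; rewrite !inE => /andP[/eqP ne_ed eF] ve.
exact/ne_ed/uniq_d.
Qed.

(** Invariant of play: the last clause balances points already earned against those still
    available. *)
Definition swept (V : finType) (E : {set {set V}}) (st : state V) : Prop :=
  [/\ edges st \subset E, mover st = P1, score2 st = 0
    & score1 st + #|covered (edges st)| = #|covered E| ].

Lemma swept_remove (V : finType) (E : {set {set V}}) (st : state V)
    (d : {set V}) :
  all_pendant E -> swept E st -> d \in edges st -> swept E (remove st d).
Proof.
move=> pE [sE mv1 sc2 sc1] dst; rewrite /remove mv1.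
have := points_pendant (all_pendantS sE pE) dst.
case: eqP => [-> //|_ _]; split=> //=.
  exact: subset_trans (subsetDl _ _) sE.
by rewrite -addnA points_covered.
Qed.

Lemma edges_remove (V : finType) (st : state V) (d : {set V}) :
  edges (remove st d) = edges st :\ d.
Proof. by rewrite /remove; case: ifP => // _; case: (mover st). Qed.

(** The mover is always [P1], so each move comes from [s1] and legality of [s1] suffices. The edge
    count shows that an edge remains before each move. *)
Lemma swept_play (V : finType) (E : {set {set V}}) (s1 s2 : strategy V)
    (n : nat) :
  all_pendant E -> legal E s1 -> n <= #|E| ->
  swept E (position E (play E s1 s2 n)) /\
  #|edges (position E (play E s1 s2 n))| + n = #|E|.
Proof.
move=> pE leg1; elim: n => [|n IHn] ltnE; first by rewrite addn0; split.
have [sw cardE] := IHn (ltnW ltnE); rewrite /=.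
set h := play E s1 s2 n in sw cardE *.
have [_ -> _ _] := sw.
have s1h : s1 h \in edges (position E h).
  apply: leg1; rewrite -card_gt0; move: ltnE.
  by rewrite -cardE -[X in X < _]add0n ltn_add2r.
split; first exact: swept_remove.
by rewrite edges_remove addnS -addSn -add1n -cardE (cardsD1 (s1 h) (edges _)) s1h.
Qed.

(** After [#|E|] moves the edge count leaves no edge, so the invariant has turned every covered
    vertex into a point of [P1]. *)
Lemma final_pendant (V : finType) (E : {set {set V}}) (s1 s2 : strategy V) :
  all_pendant E -> legal E s1 ->
  score1 (final E s1 s2) = #|covered E| /\ score2 (final E s1 s2) = 0.
Proof.
move=> pE leg1; have [sw cardE] := swept_play s2 pE leg1 (leqnn _).
have /eqP := cardE; rewrite -[X in _ == X]add0n eqn_add2r cards_eq0 => /eqP E0.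
by case: sw => _ _ sc2; rewrite E0 covered0 cards0 addn0.
Qed.

Lemma legal_exists (V : finType) (E : {set {set V}}) :
  exists s : strategy V, legal E s.
Proof.
(* The default [set0] is returned only when no edge remains, where legality demands nothing. *)
exists (fun h => odflt set0 [pick d in edges (position E h)]) => h.
by case: pickP => //= none /set0Pn[d]; rewrite (none d).
Qed.

Lemma pendant_wins (V : finType) (E : {set {set V}}) :
  E != set0 -> all_pendant E -> wins_under_optimal_play P1 E.
Proof.
move=> /set0Pn[d dE] pE; split.
  (* Any legal pair is optimal, because a legal deviation by either player leaves the final scores
     unchanged; one [s] can serve both. *)
  have [s leg] := legal_exists E; exists s, s.
  have scores t u legt := final_pendant (s1 := t) u pE legt.
  have [sc1 sc2] := scores s s leg.
  split=> // t legt; rewrite /margin /= sc1 sc2.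
    by have [-> ->] := scores t s legt.
  by have [-> ->] := scores s t leg.
move=> s1 s2 [leg1 _ _ _]; have [sc1 sc2] := final_pendant s2 pE leg1.
(* The win is strict because some edge [d] exists and its pendant endpoint is covered. *)
rewrite /wins /= sc1 sc2; have [v vd _] := pE d dE.
by apply/card_gt0P; exists v; rewrite inE; apply/exists_inP; exists d.
Qed.

Lemma star_pendant (a b : nat) : a = 1 \/ b = 1 -> all_pendant (K a b).
Proof.
move=> ab1 d /imset2P[i j _ _ ->].
(* The witness is the leaf: the endpoint opposite the one-vertex part. *)
case: ab1 => [a1|b1]; [exists (inr j) | exists (inl i)];
  rewrite ?inE ?eqxx ?orbT // => e /imset2P[i' j' _ _ ->]; rewrite !inE /=.
  move=> /eqP[->].
  by move: i i'; rewrite a1 => i i'; rewrite (ord1 i) (ord1 i').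
case/orP=> // /eqP[->].
by move: j j'; rewrite b1 => j j'; rewrite (ord1 j) (ord1 j').
Qed.

Theorem theorem5 (a b : nat) (ha : 0 < a) (hb : 0 < b)
  (hab : a = 1 \/ b = 1) :
  wins_under_optimal_play P1 (K a b).
Proof.
apply: pendant_wins (star_pendant hab); apply/set0Pn.
by exists [set inl (Ordinal ha); inr (Ordinal hb)]; apply: imset2_f.
Qed.
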